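(* Let $\mathbf{f}\in\mathcal{P}_{\mathbf{x}}^{2m\times1}$, $\mathbf{g}=(g_{ij})\in\mathcal{P}_{\mathbf{x}}^{2m\times n}$, and consider the QSDE $$d\mathbf{x}=\mathbf{f}(\mathbf{x})\,dt+\mathbf{g}(\mathbf{x})\,d\mathbf{A}^\ast+\mathbf{g}(\mathbf{x})^\ast\,d\mathbf{A},$$ together with a matrix $\mathbb{S}\in\mathbb{C}^{n\times n}$ satisfying $\mathbb{S}\mathbb{S}^\dagger=\mathbb{S}^\dagger\mathbb{S}=\mathbf{I}$. Let $\mathbf{Z}=[Z_1\cdots Z_n]^\top\in\mathcal{P}_{\mathbf{x}}^{n\times1}$ be $$Z_j=\sum_{i=1}^m\left.\int_o g_{ij}\,dp_i\right|_{\mathcal{P}_{(p_i,\dots,p_m)}}-\sum_{i=1}^m\left.\int_o g_{m+i,j}\,dq_i\right|_{\mathcal{P}_{(q_i,\dots,q_m,p_1,\dots,p_m)}},$$ and for $\mathbf{C}\in\mathbb{C}^{n\times1}$ put $$\mathbb{L}=\frac1i\,\mathbb{S}(\mathbf{Z}+\mathbf{C}),\qquad \mathbf{f}_L=\frac12\left[(\mathbb{L}^\dagger\mathbb{S}\mathbf{g}(\mathbf{x})^\top)^\top+(\mathbb{L}^\dagger\mathbb{S}\mathbf{g}(\mathbf{x})^\top)^\dagger\right].$$ Then the following conditions are equivalent: 1. The QSDEs are physically realizable. 2. Both $\mathbf{g}$ and $\mathbf{f}-\mathbf{f}_L$ are commutator-conservative mappings for some $\mathbf{C}\in\mathbb{C}^{n\times1}$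 in the definition of $\mathbb{L}$, and the elements of $\mathbf{f}$ are self-adjoint. 3. Both $\mathbf{g}$ and $\mathbf{f}-\mathbf{f}_L$ are commutator-conservative mappings for any (i.e. every) $\mathbf{C}\in\mathbb{C}^{n\times1}$ in the definition of $\mathbb{L}$, and the elements of $\mathbf{f}$ are self-adjoint.
   Context: Let $m,n\ge1$ and $\mathbf{x}=[x_1\cdots x_{2m}]^\top=[q_1\cdots q_m\;p_1\cdots p_m]^\top$ be self-adjoint operators with $[q_k,q_l]=0$, $[p_k,p_l]=0$, $[q_k,p_l]=i\delta_{kl}1$ ($\hbar=1$). $\mathcal{P}_{\mathbf{x}}$ is the class of functions that can be written as a power series $\sum_{j=1}^\infty a_jx_1^{k_{1,j}}x_2^{k_{2,j}}\cdots x_{2m}^{k_{2m,j}}$, $a_j\in\mathbb{C}$, $k_{i,j}\in\mathbb{N}=\{0,1,\dots\}$. It is a complex vector space with standard basis $\Phi$ the ordered monomials $x_1^{k_1}\cdots x_{2m}^{k_{2m}}$. Series are handled formally: an element is determined by its coefficients, linear operations act term by term, and products and adjoints (reordered with the commutation relations) that occur are understood to be well-defined elements of $\mathcal{P}_{\mathbf{x}}$. $\mathcal{O}_{\mathbf{x}}=\{X\in\mathcal{P}_{\mathbf{x}}:X=X^\ast\}$. $\mathcal{P}_{\mathbf{x}}^{k\times l}$ denotes $k\times l$ matrices over $\mathcal{P}_{\mathbf{x}}$. For a subset $\mathbf{z}$ of $\{x_1,\dots,x_{2m}\}$, $\mathcal{P}_{\mathbf{z}}$ is the subspace of power series in the elements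 of $\mathbf{z}$ only (constants included). $X|_{\mathcal{A}}$, for $\mathcal{A}$ spanned by a subset of $\Phi$, is the projection keeping only the terms whose monomial is in that subset. Zero integral: $\int_o X\,dx_i$ is defined termwise by $\int_o x_1^{k_1}\cdots x_i^{k_i}\cdots x_{2m}^{k_{2m}}\,dx_i=\frac{1}{k_i+1}x_1^{k_1}\cdots x_i^{k_i+1}\cdots x_{2m}^{k_{2m}}$. For matrices of operators, $^\ast$ is the entrywise adjoint, $^\top$ the transpose, $^\dagger$ the adjoint transpose. For vectors of operators, $[\mathbf{x},\mathbf{y}^\top]=\mathbf{x}\mathbf{y}^\top-(\mathbf{y}\mathbf{x}^\top)^\top$ is the matrix with entries $[x_i,y_j]$. Commutator-conservative: $\mathbf{g}\in\mathcal{P}_{\mathbf{x}}^{2m\times k}$ is commutator-conservative if there exists $\mathbb{J}\in\mathcal{P}_{\mathbf{x}}^{k\times1}$ with $\mathbf{g}=-i[\mathbf{x},\mathbb{J}^\top]$ (used with $k=n$ for $\mathbf{g}$ and $k=1$ for $\mathbf{f}-\mathbf{f}_L$). Physically realizable: the QSDE $d\mathbf{x}=\mathbf{f}(\mathbf{x})dt+\mathbf{g}(\mathbf{x})d\mathbf{A}^\ast+\mathbf{g}(\mathbf{x})^\ast d\mathbf{A}$ ($\mathbf{A}$ the vector of $n$ annihilation processes) is physically realizable if the elements of $\mathbf{f}$ lie in $\mathcal{O}_{\mathbf{x}}$ and there exist $\mathbb{H}\in\mathcal{O}_{\mathbf{x}}$, $\mathbb{L}\in\mathcal{P}_{\mathbf{x}}^{n\times1}$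 and a (scattering) matrix $\mathbb{S}\in\mathbb{C}^{n\times n}$ with $\mathbb{S}\mathbb{S}^\dagger=\mathbb{S}^\dagger\mathbb{S}=\mathbf{I}$, such that $\mathbf{f}(\mathbf{x})=-i[\mathbf{x},\mathbb{H}]+\frac12\left[(\mathbb{L}^\dagger\mathbb{S}\mathbf{g}(\mathbf{x})^\top)^\top+(\mathbb{L}^\dagger\mathbb{S}\mathbf{g}(\mathbf{x})^\top)^\dagger\right]$ and $\mathbf{g}(\mathbf{x})=[\mathbf{x},\mathbb{L}^\top]\mathbb{S}^\ast$. *)

(* Defs.v *)
From HB Require Import structures.
From mathcomp Require Import all_boot all_order all_algebra finmap complex.
From mathcomp Require Import mathcomp_extra boolp classical_sets functions reals.

Set Implicit Arguments.
Unset Strict Implicit.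
Unset Printing Implicit Defensive.

Import Order.TTheory GRing.Theory Num.Theory.
Local Open Scope ring_scope.

Section Summation.
Context {R : realType} {I : choiceType}.
Implicit Type u : I -> R[i].

(* Unconditional convergence along finite subsets; over the complex numbers
   this is absolute convergence. *)
Definition has_sum u (s : R[i]) : Prop :=
  forall e : R, 0 < e -> exists F : {fset I}, forall G : {fset I},
    (F `<=` G)%fset -> `|\sum_(i <- G) u i - s| < (e%:C)%C.

Definition summable u : Prop := exists s, has_sum u s.

(* Junk value 0 when u is not summable. *)
Definition tsum u : R[i] := xget 0 [set s | has_sum u s]%classic.

End Summation.

(* x_1, ..., x_2m is q_1, ..., q_m, p_1, ..., p_m. *)
Definition qidx {m : nat} (s : 'I_m) : 'I_(m + m) := lshift m s.
Definition pidx {m : nat} (s : 'I_m) : 'I_(m + m) := rshift m s.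

(* The exponents k of the ordered monomial x_1^k_1 ... x_2m^k_2m. *)
Definition mindex (m : nat) := {ffun 'I_(m + m) -> nat}.

(* Formal series in the ordered monomials, as coefficient families. The
   pointwise product of families is deliberately not inherited: the operator
   product is [smul] below. *)
Definition series (R : realType) (m : nat) : Type := mindex m -> R[i].

HB.instance Definition _ (R : realType) (m : nat) :=
  GRing.Lmodule.copy (series R m) (mindex m -> R[i]^o).

Section Series.
Context {R : realType} {m : nat}.
Implicit Types (k l r : mindex m) (X Y : series R m).

Definition mon k : series R m := fun l => (l == k)%:R.

Definition mindex0 : mindex m := [ffun=> 0%N].
Definition mindex1 (i : 'I_(m + m)) : mindex m := [ffun j => nat_of_bool (j == i)].

Definition sconst (a : R[i]) : series R m := a *: mon mindex0.
Definition xvar (i : 'I_(m + m)) : series R m := mon (mindex1 i).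

(* Coefficient of q^e p^f in (q^a p^b)(q^c p^d) for one mode, from the
   consequence of [q, p] = i
     p^b q^c = \sum_j (-i)^j j! C(b, j) C(c, j) q^(c - j) p^(b - j). *)
Definition mode_coef (a b c d e f : nat) : R[i] :=
  \sum_(j < b.+1 | (e + j == a + c)%N && (f + j == b + d)%N)
     (- 'i) ^+ j * (j`! * 'C(b, j) * 'C(c, j))%:R.

(* The ordered expansion of the product of the monomials k and l; distinct
   modes commute. *)
Definition mon_mul k l : series R m := fun r =>
  \prod_(s < m) mode_coef (k (qidx s)) (k (pidx s)) (l (qidx s)) (l (pidx s))
                          (r (qidx s)) (r (pidx s)).

Definition qpart k : mindex m := [ffun i : 'I_(m + m) => if (i < m)%N then k i else 0%N].
Definition ppart k : mindex m := [ffun i : 'I_(m + m) => if (i < m)%N then 0%N else k i].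

(* The adjoint of q^a p^b is p^b q^a, reordered. *)
Definition mon_adj k : series R m := mon_mul (ppart k) (qpart k).

(* Products and adjoints of series are reordered term by term; the resulting
   coefficients are in general infinite sums. *)
Definition smul_terms X Y r (kl : mindex m * mindex m) : R[i] :=
  X kl.1 * Y kl.2 * mon_mul kl.1 kl.2 r.
Definition smul X Y : series R m := fun r => tsum (smul_terms X Y r).
Definition smul_defined X Y : Prop := forall r, summable (smul_terms X Y r).

Definition sadj_terms X r k : R[i] := (X k)^* * mon_adj k r.
Definition sadj X : series R m := fun r => tsum (sadj_terms X r).
Definition sadj_defined X : Prop := forall r, summable (sadj_terms X r).

(* The class P_x. The adjoint of an element of P_x is a well-defined element
   of P_x, and the adjoint is an involution; for series as bare coefficient
   families this is a condition, since the reordering of X may diverge, and reordering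
   twice may diverge or, because of the exchange of limits, differ from X. *)
Definition inP X : Prop :=
  [/\ sadj_defined X, sadj_defined (sadj X) & sadj (sadj X) = X].

(* The class O_x. *)
Definition inO X : Prop := inP X /\ X = sadj X.

Definition restr (z : {set 'I_(m + m)}) X : series R m := fun k =>
  if [forall i, (k i != 0%N) ==> (i \in z)] then X k else 0.

Definition zint (i : 'I_(m + m)) X : series R m := fun k =>
  if k i is d.+1
  then X [ffun j => if j == i then d else k j] / d.+1%:R
  else 0.

End Series.

Section SeriesMatrices.
Context {R : realType} {m : nat}.

Definition inPmx {a b} (A : 'M[series R m]_(a, b)) : Prop :=
  forall i j, inP (A i j).

Definition mxmul {a b c} (A : 'M[series R m]_(a, b)) (B : 'M[series R m]_(b, c))
  : 'M[series R m]_(a, c) := \matrix_(i, j) \sum_k smul (A i k) (B k j).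

Definition mxmul_defined {a b c} (A : 'M[series R m]_(a, b))
    (B : 'M[series R m]_(b, c)) : Prop :=
  (forall i j k, smul_defined (A i k) (B k j)) /\ inPmx (mxmul A B).

Definition mxscale {a b} (c : R[i]) (A : 'M[series R m]_(a, b)) :=
  map_mx (fun X : series R m => c *: X) A.

Definition mxconst {a b} (A : 'M[R[i]]_(a, b)) : 'M[series R m]_(a, b) :=
  map_mx sconst A.

Definition mxdag {a b} (A : 'M[series R m]_(a, b)) : 'M[series R m]_(b, a) :=
  (map_mx sadj A)^T.

Definition xvec : 'cV[series R m]_(m + m) := \col_i xvar i.

(* [u, v^T] = u v^T - (v u^T)^T *)
Definition comm {a b} (u : 'cV[series R m]_a) (v : 'cV[series R m]_b) :
  'M[series R m]_(a, b) := mxmul u v^T - (mxmul v u^T)^T.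

Definition commutator_conservative {k} (g : 'M[series R m]_(m + m, k)) : Prop :=
  exists2 J : 'cV[series R m]_k, inPmx J & g = mxscale (- 'i) (comm xvec J).

End SeriesMatrices.

Section QSDE.
Context {R : realType} {m n : nat}.
Implicit Types (f : 'cV[series R m]_(m + m)) (g : 'M[series R m]_(m + m, n)).
Implicit Types (L : 'cV[series R m]_n) (S : 'M[R[i]]_n) (C : 'cV[R[i]]_n).

Definition unitary S : Prop :=
  S *m (map_mx Num.conj S)^T = 1%:M /\ (map_mx Num.conj S)^T *m S = 1%:M.

(* L^dagger S g^T, a row *)
Definition LSg L S g : 'rV[series R m]_(m + m) :=
  mxmul (mxmul (mxdag L) (mxconst S)) g^T.

Definition LSg_defined L S g : Prop :=
  mxmul_defined (mxmul (mxdag L) (mxconst S)) g^T.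

Definition drift_correction L S g : 'cV[series R m]_(m + m) :=
  mxscale 2^-1 ((LSg L S g)^T + mxdag (LSg L S g)).

Definition physically_realizable f g : Prop :=
  (forall i, inO (f i 0)) /\
  exists (H : series R m) (L : 'cV[series R m]_n) (S : 'M[R[i]]_n),
    [/\ inO H, inPmx L, unitary S, LSg_defined L S g &
        f = mxscale (- 'i) (comm xvec (\col_(_ < 1) H)) + drift_correction L S g
        /\ g = mxmul (comm xvec L) (mxconst (map_mx Num.conj S))].

Definition Zvec g : 'cV[series R m]_n := \col_j
  (\sum_(i < m) restr [set pidx s | s : 'I_m & (i <= s)%N]
                      (zint (pidx i) (g (qidx i) j))
   - \sum_(i < m) restr ([set qidx s | s : 'I_m & (i <= s)%N]
                         :|: [set pidx s | s : 'I_m])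
                        (zint (qidx i) (g (pidx i) j))).

Definition Lvec g S C : 'cV[series R m]_n :=
  mxscale ('i^-1) (mxmul (mxconst S) (Zvec g + mxconst C)).

Definition fL g S C : 'cV[series R m]_(m + m) :=
  drift_correction (Lvec g S C) S g.

End QSDE.

(* Main.v *)
(* The bracket with x_i acts on formal series as a derivation:
   -i [q_s, X] = dX/dp_s and -i [p_s, X] = - dX/dq_s. So g is
   commutator-conservative iff its columns are Hamiltonian vector fields of
   potentials J_j, and integrating term by term, each monomial being counted at
   its first variable only, recovers Z_j = J_j up to the constant term. A
   realization (H, L', S') of g has i S'^dagger L' as potential, which thus
   is Z + C for some constant C, and the drift correction depends on L', S' only
   through S'^dagger L', so f - f_L = -i [x, H].
   Changing C adds to f_L the Hermitian part of a Hamiltonian vector field, which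
   is again one because the bracket with i x_j commutes with adjoints. For the
   same reason the potential of f - f_L can be replaced by its Hermitian part
   when f is self-adjoint. *)
From HB Require Import structures.
Require Import Defs.
From mathcomp Require Import all_boot all_order all_algebra complex reals.
From mathcomp Require Import finmap boolp classical_sets ring zify.

Import Order.TTheory GRing.Theory Num.Theory.
Local Open Scope ring_scope.

(** * Unconditional sums *)

Section HasSum.
Context {R : realType} {I : choiceType}.
Implicit Types (u v : I -> R[i]) (s t a : R[i]).

Lemma norm_complex s : exists d : R, `|s| = (d%:C)%C.
Proof. by apply/complex_realP/normr_real. Qed.

(** The bound is kept positive even for [s = 0], because a tolerance gets divided by it when a sum
    is scaled. *)
Lemma norm_le_real s : exists2 M : R, 0 < M & `|s| <= (M%:C)%C.
Proof.
have [M defM] := norm_complex s.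
have M0 : 0 <= M by rewrite -lecR -defM normr_ge0.
exists (M + 1); first by rewrite ltr_wpDl.
by rewrite defM lecR lerDl.
Qed.

Lemma has_sum_unique u s t : has_sum u s -> has_sum u t -> s = t.
Proof.
move=> us ut; apply/eqP; rewrite -subr_eq0 -normr_eq0.
have [d defd] := norm_complex (s - t).
have : 0 <= d by rewrite -lecR -defd normr_ge0.
rewrite le_eqVlt => /predU1P[d0 | d0]; first by rewrite defd -d0.
(* A finite set good for both limits at tolerance [d / 2] would put [s] and [t] at distance less
   than [d], which is their distance. *)
have e0 : 0 < d / 2 by rewrite divr_gt0.
have [F1 H1] := us _ e0; have [F2 H2] := ut _ e0.
have {H1}h1 := H1 _ (fsubsetUl F1 F2); have {H2}h2 := H2 _ (fsubsetUr F1 F2).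
move: h1 h2; set S := (X in `|X - s|) => h1 h2.
have : `|s - t| < ((d / 2)%:C)%C + ((d / 2)%:C)%C.
  apply: le_lt_trans (ltrD h1 h2).
  by rewrite [leRHS]addrC -(distrC s S) -[s - t](subrKA S) addrC; exact: ler_normD.
by rewrite defd -rmorphD /= -splitr ltxx.
Qed.

Lemma tsumE u s : has_sum u s -> tsum u = s.
Proof. by move=> us; apply: xget_unique => // t ut; exact: has_sum_unique ut us. Qed.

Lemma summableE u : summable u -> has_sum u (tsum u).
Proof. by case=> s us; rewrite (tsumE _ _ us). Qed.

Lemma eq_has_sum u v s : u =1 v -> has_sum u s -> has_sum v s.
Proof. by move=> /funext ->. Qed.

Lemma has_sum1 (i : I) a u :
  (forall j, u j = if j == i then a else 0) -> has_sum u a.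
Proof.
move=> ui e e0; exists [fset i]%fset => G /fsubsetP/(_ i).
rewrite inE eqxx => /(_ isT) iG.
rewrite (big_fsetD1 i iG) /= ui eqxx big_seq_cond big1 ?addr0 ?subrr ?normr0 ?ltcR //.
by move=> j; rewrite andbT !inE => /andP[/negPf ji _]; rewrite ui ji.
Qed.

Lemma has_sumD u v s t :
  has_sum u s -> has_sum v t -> has_sum (fun i => u i + v i) (s + t).
Proof.
move=> us vt e e0; have e20 : 0 < e / 2 by rewrite divr_gt0.
have [F1 H1] := us _ e20; have [F2 H2] := vt _ e20.
exists (F1 `|` F2)%fset => G /fsubUsetP[/H1 h1 /H2 h2].
rewrite big_split /= opprD addrACA (splitr e) rmorphD.
exact: le_lt_trans (ler_normD _ _) (ltrD h1 h2).
Qed.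

Lemma has_sumZ a u s : has_sum u s -> has_sum (fun i => a * u i) (a * s).
Proof.
move=> us e e0; have [M M0 aM] := norm_le_real a.
have [F H] := us _ (divr_gt0 e0 M0).
exists F => G /H h; rewrite -mulr_sumr -mulrBr normrM.
have -> : (e%:C = M%:C * (e / M)%:C)%C by rewrite -rmorphM /= mulrC divfK ?gt_eqF.
apply: le_lt_trans (ler_wpM2r (normr_ge0 _) aM) _.
by rewrite ltr_pM2l // (ltcR 0).
Qed.

End HasSum.

(** The map [h] is injective and [u] vanishes off its image, so only the indexing of the nonzero
    terms changes. *)
Lemma has_sum_reindex {R : realType} {I J : choiceType} (h : J -> I) (h' : I -> J)
    (u : I -> R[i]) (s : R[i]) :
    cancel h h' -> (forall i, h (h' i) != i -> u i = 0) ->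
  has_sum u s -> has_sum (u \o h) s.
Proof.
move=> hK u0 us e e0; have [F H] := us _ e0.
(* Once [G] contains these indices, a point of [F] outside [h(G)] is outside the image of [h]. There
   [u] is 0, so the sums over [h(G)] and over its union with [F] agree. *)
exists [fset h' i | i in F]%fset => G /fsubsetP FG.
have /H : (F `<=` [fset h j | j in G] `|` F)%fset by exact: fsubsetUr.
rewrite -(big_fset_incl _ (fsubsetUl [fset h j | j in G]%fset F)); last first.
  move=> i; rewrite inE => /orP[-> //|iF] iG.
  apply: u0; apply: contraNneq iG => <-.
  by apply: in_imfset; apply: FG; apply: in_imfset.
by rewrite big_imfset //= => i j _ _ /(can_inj hK).
Qed.

(** * Reordering of monomials *)

Section ModeCoef.
Context {R : realType}.
Implicit Types a b c d e f : nat.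

Lemma mode_coef_1l c d e f :
  mode_coef 0 0 c d e f = ((e == c) && (f == d))%:R :> R[i].
Proof.
rewrite /mode_coef big_mkcond big_ord_recl big_ord0 /= addr0 !addn0 !add0n.
by rewrite expr0 !bin0 mulr1; case: ifP.
Qed.


Lemma mode_coef_1r a b e f :
  mode_coef a b 0 0 e f = ((e == a) && (f == b))%:R :> R[i].
Proof.
rewrite /mode_coef big_mkcond big_ord_recl big1 => [|j _]; last first.
  by rewrite bin0n muln0 mulr0 if_same.
by rewrite /= addr0 !addn0 expr0 !bin0 mulr1; case: ifP.
Qed.

Lemma mode_coef_ql c d e f :
  mode_coef 1 0 c d e f = ((e == c.+1) && (f == d))%:R :> R[i].
Proof.
rewrite /mode_coef big_mkcond big_ord_recl big_ord0 /= addr0 !addn0 !add0n add1n.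
by rewrite expr0 !bin0 mulr1; case: ifP.
Qed.

Lemma mode_coef_pr a b e f :
  mode_coef a b 0 1 e f = ((e == a) && (f == b.+1))%:R :> R[i].
Proof.
rewrite /mode_coef big_mkcond big_ord_recl big1 => [|j _]; last first.
  by rewrite bin0n muln0 mulr0 if_same.
by rewrite /= addr0 !addn0 expr0 !bin0 mulr1 addn1; case: ifP.
Qed.

(** This is p q^c = q^c p - i c q^(c-1): a single p leaves only j = 0 and j = 1. The factor c is
    written [e.+1], its value where the second term lives, so that it reads as a formal
    derivative. *)
Lemma mode_coef_pl c d e f :
  mode_coef 0 1 c d e f = ((e == c) && (f == d.+1))%:R
    + - 'i * e.+1%:R * ((c == e.+1) && (d == f))%:R :> R[i].
Proof.
rewrite /mode_coef big_mkcond !big_ord_recl big_ord0 /= addr0 /bump /=.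
rewrite !addn0 !addn1 !add0n add1n !bin0 expr0 !mul1r eqSS; congr (_ + _).
  by case: ifP.
rewrite [c == _]eq_sym [d == _]eq_sym.
case: ifP => [/andP[/eqP <- _]|]; rewrite /= ?mulr0 ?mulr1 //. by rewrite expr1 !bin1 !mul1n.
Qed.

(** The mirror rule p^b q = q p^b - i b p^(b-1); summands with j > 1 carry C(1, j) = 0. *)
Lemma mode_coef_qr a b e f :
  mode_coef a b 1 0 e f = ((e == a.+1) && (f == b))%:R
    + - 'i * f.+1%:R * ((a == e) && (b == f.+1))%:R :> R[i].
Proof.
rewrite /mode_coef big_mkcond big_ord_recl /= /bump /=.
rewrite !addn0 !addn1 !bin0 expr0 !mul1r; congr (_ + _); first by case: ifP.
case: b => [|b]; first by rewrite big_ord0 andbF mulr0.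
rewrite big_ord_recl big1 => [|j _]; last by rewrite (@bin_small 1) ?muln0 ?mulr0 ?if_same.
rewrite /= addr0 !addn1 !eqSS expr1 bin1 mul1n muln1.
rewrite [a == _]eq_sym [b == _]eq_sym.
by case: ifP => [/andP[_ /eqP <-]|]; rewrite ?mulr0 ?mulr1.
Qed.

(* The coefficients of p^b q^c. *)
Lemma mode_coef_adj b c e f :
  mode_coef 0 b c 0 e f =
    if (f <= b)%N && (e + (b - f) == c)%N
    then (- 'i) ^+ (b - f) * ((b - f)`! * 'C(b, b - f) * 'C(c, b - f))%:R
    else 0 :> R[i].
Proof.
rewrite /mode_coef; case: ifP => [/andP[fb ec]|nfb].
  have lt_bf : (b - f < b.+1)%N by rewrite ltnS leq_subr.
  rewrite (big_pred1 (Ordinal lt_bf)) // => j; rewrite add0n addn0.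
  by apply/andP/eqP => [[/eqP ? /eqP ?]|-> /=]; [apply: val_inj => /=|]; lia.
by rewrite big_pred0 // => j; apply: contraFF nfb; lia.
Qed.

(** Reordering p^b q^c commutes with d/dp. On coefficients this is (b + 1) C(b, j) = (b + 1 - j) C(b
    + 1, j) at j = b - f. *)
Lemma mode_coef_adj_derivp b c e f :
  f.+1%:R * mode_coef 0 b.+1 c 0 e f.+1 = b.+1%:R * mode_coef 0 b c 0 e f :> R[i].
Proof.
rewrite !mode_coef_adj ltnS subSS; case: ifP => [/andP[fb _]|]; last by rewrite !mulr0.
rewrite !(mulrCA _ (_ ^+ _)) -!natrM; congr (_ * _%:R).
have := mul_bin_down b.+1 (b - f); have -> : (b.+1 - (b - f) = f.+1)%N by lia.
move=> /= h; rewrite !mulnA [X in (X * _ = _)%N]mulnAC -h; lia.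
Qed.

Lemma mode_coef_adj_derivq b c e f :
  e.+1%:R * mode_coef 0 b c.+1 0 e.+1 f = c.+1%:R * mode_coef 0 b c 0 e f :> R[i].
Proof.
rewrite !mode_coef_adj addSn eqSS; case: ifP => [/andP[fb /eqP ec]|]; last by rewrite !mulr0.
rewrite !(mulrCA _ (_ ^+ _)) -!natrM; congr (_ * _%:R).
have := mul_bin_down c.+1 (b - f); have -> : (c.+1 - (b - f) = e.+1)%N by lia.
by move=> /= h; rewrite mulnCA -h mulnCA.
Qed.

Lemma mode_coef_adj_p0 c e f : mode_coef 0 0 c 0 e f.+1 = 0 :> R[i].
Proof. by rewrite mode_coef_adj. Qed.

Lemma mode_coef_adj_q0 b e f : mode_coef 0 b 0 0 e.+1 f = 0 :> R[i].
Proof. by rewrite mode_coef_adj addSn andbF. Qed.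

End ModeCoef.

Section Monomials.
Context {R : realType} {m : nat}.
Implicit Types (k l r : mindex m) (s t : 'I_m) (i : 'I_(m + m)).

Definition incr i k : mindex m := [ffun j => if j == i then (k j).+1 else k j].
Definition decr i k : mindex m := [ffun j => if j == i then (k j).-1 else k j].

Lemma incrE i k j : incr i k j = if j == i then (k j).+1 else k j.
Proof. by rewrite ffunE. Qed.

Lemma incrK i : cancel (incr i) (decr i).
Proof. by move=> k; apply/ffunP => j; rewrite !ffunE; case: eqP. Qed.

Lemma decrK i k : (0 < k i)%N -> incr i (decr i k) = k.
Proof.
move=> ki; apply/ffunP => j; rewrite !ffunE.
by case: eqP => // ->; rewrite prednK.
Qed.

(* The index of the variable conjugate to [x_i]. *)
Definition cbar i := match split i with inl s => pidx s | inr s => qidx s end.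

Lemma cbar_q s : cbar (qidx s) = pidx s.
Proof. by rewrite /cbar (unsplitK (inl s)). Qed.

Lemma cbar_p s : cbar (pidx s) = qidx s.
Proof. by rewrite /cbar (unsplitK (inr s)). Qed.

Lemma idxP i : (exists s, i = qidx s) \/ (exists s, i = pidx s).
Proof. by case: (split_ordP i) => s ->; [left | right]; exists s. Qed.

Lemma qidx_eq s t : (qidx s == qidx t) = (s == t). Proof. exact: eq_lshift. Qed.
Lemma pidx_eq s t : (pidx s == pidx t) = (s == t). Proof. exact: eq_rshift. Qed.
Lemma qpidx_eq s t : (qidx s == pidx t) = false. Proof. exact: eq_lrshift. Qed.
Lemma pqidx_eq s t : (pidx s == qidx t) = false. Proof. exact: eq_rlshift. Qed.
Definition idx_eqE := (qidx_eq, pidx_eq, qpidx_eq, pqidx_eq).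

Lemma qidx_lt s : (qidx s < m)%N. Proof. exact: (ltn_ord s). Qed.
Lemma pidx_lt s : (pidx s < m)%N = false.
Proof. by apply/negbTE; rewrite -leqNgt leq_addr. Qed.

(** Splitting the Kronecker delta over the modes gives it the product shape of [mon_mul], so the two
    can be compared mode by mode. *)
Lemma mindex_eqE k l :
  (k == l)%:R =
  \prod_(s < m) ((k (qidx s) == l (qidx s)) && (k (pidx s) == l (pidx s)))%:R :> R[i].
Proof.
have [->|nkl] := eqVneq k l; first by rewrite big1 // => s _; rewrite !eqxx.
case: (pickP (fun i => k i != l i)) => [i|all_eq]; last first.
  by case/eqP: nkl; apply/ffunP => i; apply/eqP/negbFE; exact: all_eq.
by case: (idxP i) => [[s ->]|[s ->]] /negPf ns;
  rewrite (bigD1 s) //= ns ?andbF mul0r.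
Qed.

(* [x_i X] and [X x_i] are [xshift i X] (below) plus these multiples of the
   formal derivative of [X] in the variable conjugate to [x_i]. *)
Definition xmul_coef i : R[i] := if (i < m)%N then 0 else - 'i.
Definition mulx_coef i : R[i] := if (i < m)%N then - 'i else 0.

(** Only the mode of x_i is affected. A factor q on the left is already in order, whereas a factor p
    must cross the power of its conjugate q, which yields the second term. *)
Lemma mon_mul_xl i l r :
  mon_mul (mindex1 i) l r = (r == incr i l)%:R
    + xmul_coef i * (r (cbar i)).+1%:R * (l == incr (cbar i) r)%:R :> R[i].
Proof.
rewrite /mon_mul !mindex_eqE /xmul_coef; case: (idxP i) => [[t ->]|[t ->]].
  rewrite qidx_lt !mul0r addr0; apply: eq_bigr => s _.
  rewrite !incrE !ffunE !idx_eqE.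
  by case: eqP => _; rewrite ?mode_coef_ql ?mode_coef_1l.
rewrite pidx_lt cbar_p ![\prod_(s < m) _](bigD1 t) //= !incrE !ffunE !idx_eqE !eqxx.
rewrite mode_coef_pl mulrDl !mulrA; congr (_ * _ + _ * _).
  apply: eq_bigr => s /negPf st; rewrite !incrE !ffunE !idx_eqE st.
  by rewrite mode_coef_1l.
apply: eq_bigr => s /negPf st; rewrite !incrE !ffunE !idx_eqE st.
by rewrite mode_coef_1l ![l _ == _]eq_sym.
Qed.

Lemma mon_mul_xr i l r :
  mon_mul l (mindex1 i) r = (r == incr i l)%:R
    + mulx_coef i * (r (cbar i)).+1%:R * (l == incr (cbar i) r)%:R :> R[i].
Proof.
rewrite /mon_mul !mindex_eqE /mulx_coef; case: (idxP i) => [[t ->]|[t ->]]; last first.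
  rewrite pidx_lt !mul0r addr0; apply: eq_bigr => s _.
  rewrite !incrE !ffunE !idx_eqE.
  by case: eqP => _; rewrite ?mode_coef_pr ?mode_coef_1r.
rewrite qidx_lt cbar_q ![\prod_(s < m) _](bigD1 t) //= !incrE !ffunE !idx_eqE !eqxx.
rewrite mode_coef_qr mulrDl !mulrA; congr (_ * _ + _ * _).
  apply: eq_bigr => s /negPf st; rewrite !incrE !ffunE !idx_eqE st.
  by rewrite mode_coef_1r.
apply: eq_bigr => s /negPf st; rewrite !incrE !ffunE !idx_eqE st.
by rewrite mode_coef_1r ![l _ == _]eq_sym.
Qed.

Lemma mon_mul_0l l r : mon_mul mindex0 l r = (r == l)%:R :> R[i].
Proof.
by rewrite /mon_mul mindex_eqE; apply: eq_bigr => s _; rewrite !ffunE mode_coef_1l.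
Qed.

Lemma mon_mul_0r l r : mon_mul l mindex0 r = (r == l)%:R :> R[i].
Proof.
by rewrite /mon_mul mindex_eqE; apply: eq_bigr => s _; rewrite !ffunE mode_coef_1r.
Qed.

Lemma mon_adjE k r : mon_adj k r =
  \prod_(s < m) mode_coef 0 (k (pidx s)) (k (qidx s)) 0 (r (qidx s)) (r (pidx s)) :> R[i].
Proof. by apply: eq_bigr => s _; rewrite !ffunE qidx_lt pidx_lt. Qed.

Lemma mon_adj0 r : mon_adj mindex0 r = (r == mindex0)%:R :> R[i].
Proof.
by rewrite mon_adjE mindex_eqE; apply: eq_bigr => s _; rewrite !ffunE mode_coef_1l.
Qed.

(* Taking adjoints commutes with formal differentiation in [x_i]. *)
Lemma mon_adj_incr i k r :
  (r i).+1%:R * mon_adj (incr i k) (incr i r) = (k i).+1%:R * mon_adj k r :> R[i].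
Proof.
rewrite !mon_adjE; case: (idxP i) => [[t ->]|[t ->]];
rewrite ![\prod_(s < m) _](bigD1 t) //= !mulrA !incrE !idx_eqE !eqxx.
  rewrite mode_coef_adj_derivq; congr (_ * _); apply: eq_bigr => s /negPf st.
  by rewrite !incrE !idx_eqE st.
rewrite mode_coef_adj_derivp; congr (_ * _); apply: eq_bigr => s /negPf st.
by rewrite !incrE !idx_eqE st.
Qed.

(** Reordering only lowers exponents, so a variable absent from a monomial is absent from its
    adjoint. *)
Lemma mon_adj_incr0 i k r : k i = 0%N -> mon_adj k (incr i r) = 0 :> R[i].
Proof.
rewrite mon_adjE; case: (idxP i) => [[t ->]|[t ->]] k0;
rewrite (bigD1 t) //= !incrE !idx_eqE !eqxx k0.
  by rewrite mode_coef_adj_q0 mul0r.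
by rewrite mode_coef_adj_p0 mul0r.
Qed.

End Monomials.

(** * Products, brackets and adjoints of series *)

Section SeriesOperations.
Context {R : realType} {m : nat}.
Implicit Types (k l r : mindex m) (i : 'I_(m + m)) (X Y : series R m) (a : R[i]).

Lemma seriesP X Y : (forall r, X r = Y r) -> X = Y.
Proof. by move=> XY; apply/funext. Qed.

Lemma seriesDE X Y r : (X + Y) r = X r + Y r. Proof. by []. Qed.
Lemma seriesZE a X r : (a *: X) r = a * X r. Proof. by []. Qed.
Lemma seriesNE X r : (- X) r = - X r. Proof. by []. Qed.
Lemma series_sumE {I} (s : seq I) P (F : I -> series R m) r :
  (\sum_(i <- s | P i) F i) r = \sum_(i <- s | P i) F i r.
Proof. by elim/big_rec2: _ => // j y z _ <-. Qed.

Definition xshift i X : series R m :=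
  fun r => if (0 < r i)%N then X (decr i r) else 0.

Lemma eq_incr i k r : (r == incr i k) = (0 < r i)%N && (k == decr i r).
Proof.
apply/eqP/andP => [->|[ri /eqP ->]]; last by rewrite decrK.
by rewrite incrK incrE eqxx.
Qed.

(** At most two monomials of [X] contribute to a given coefficient of the product, so it exists for
    every series. *)
Lemma has_sum_smul_xl i X r : has_sum (smul_terms (xvar i) X r)
  (xshift i X r + xmul_coef i * (r (cbar i)).+1%:R * X (incr (cbar i) r)).
Proof.
pose u (kl : mindex m * mindex m) (k : mindex m) v : R[i] :=
  if kl == (mindex1 i, k) then v else 0.
have us k v : has_sum (fun kl => u kl k v) v by exact: has_sum1.
apply: eq_has_sum (has_sumD _ _ _ _ (us (decr i r) _) (us (incr (cbar i) r) _)).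
case=> k l; rewrite /smul_terms /u /= /xvar /mon !xpair_eqE.
case: eqP => [->|_] /=; last by rewrite !mul0r addr0.
rewrite mon_mul_xl mul1r mulrDr (eq_incr i l r) /xshift; congr (_ + _).
  (* When [r i = 0], the truncated [decr i r] is [r] itself, a spurious index to which [xshift]
     gives the value 0. *)
  have [->|_] := eqVneq l (decr i r); last by rewrite andbF mulr0.
  by rewrite andbT; case: ifP; rewrite ?mulr1 ?mulr0.
by case: eqP => [->|_]; rewrite ?mulr1 ?mulr0 // mulrC.
Qed.

Lemma has_sum_smul_xr i X r : has_sum (smul_terms X (xvar i) r)
  (xshift i X r + mulx_coef i * (r (cbar i)).+1%:R * X (incr (cbar i) r)).
Proof.
pose u (kl : mindex m * mindex m) (k : mindex m) v : R[i] :=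
  if kl == (k, mindex1 i) then v else 0.
have us k v : has_sum (fun kl => u kl k v) v by exact: has_sum1.
apply: eq_has_sum (has_sumD _ _ _ _ (us (decr i r) _) (us (incr (cbar i) r) _)).
case=> l k; rewrite /smul_terms /u /= /xvar /mon !xpair_eqE !(andbC (l == _)).
case: eqP => [->|_] /=; last by rewrite mulr0 !mul0r addr0.
rewrite mon_mul_xr mulr1 mulrDr (eq_incr i l r) /xshift; congr (_ + _).
  have [->|_] := eqVneq l (decr i r); last by rewrite andbF mulr0.
  by rewrite andbT; case: ifP; rewrite ?mulr1 ?mulr0.
by case: eqP => [->|_]; rewrite ?mulr1 ?mulr0 // mulrC.
Qed.

(* [-i [x_i, X]], that is [dX/dp_s] for [x_i = q_s] and [- dX/dq_s] for
   [x_i = p_s]. *)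
Definition ham i X : series R m :=
  fun r => (if (i < m)%N then 1 else -1) * (r (cbar i)).+1%:R * X (incr (cbar i) r).

Lemma ham_is_linear i : linear (ham i).
Proof.
move=> a X Y; apply: seriesP => r.
by rewrite /ham !(seriesDE, seriesZE) mulrDr mulrCA.
Qed.

HB.instance Definition _ i :=
  GRing.isLinear.Build R[i] (series R m) (series R m) _ (ham i) (ham_is_linear i).

Lemma hamD i X Y : ham i (X + Y) = ham i X + ham i Y.
Proof. exact: linearD. Qed.

Lemma hamB i X Y : ham i (X - Y) = ham i X - ham i Y.
Proof. exact: linearB. Qed.

Lemma hamZ i a X : ham i (a *: X) = a *: ham i X.
Proof. exact: linearZZ. Qed.

(** The shifts cancel, and [xmul_coef i - mulx_coef i] is i for a q and -i for a p. *)
Lemma comm_ham i X : smul (xvar i) X - smul X (xvar i) = 'i *: ham i X.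
Proof.
apply: seriesP => r; rewrite seriesDE seriesNE seriesZE /smul /ham.
rewrite (tsumE _ _ (has_sum_smul_xl i X r)) (tsumE _ _ (has_sum_smul_xr i X r)).
rewrite opprD addrACA subrr add0r /xmul_coef /mulx_coef; case: ifP => _.
  by rewrite !mul0r; ring.
by rewrite !mul0r; ring.
Qed.

Lemma ham_sconst i a : ham i (sconst a) = 0.
Proof.
apply: seriesP => r; rewrite /ham /sconst seriesZE /mon.
case: eqP => [/ffunP/(_ (cbar i))|_]; last by rewrite mulr0 mulr0.
by rewrite incrE eqxx ffunE.
Qed.

Lemma sconstM a b : sconst (a * b) = a *: sconst b :> series R m.
Proof. by rewrite /sconst scalerA. Qed.

Lemma sconstB a b : sconst (a - b) = sconst a - sconst b :> series R m.
Proof. exact: scalerBl. Qed.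

Lemma has_sum_smul_sconstl a X r : has_sum (smul_terms (sconst a) X r) (a * X r).
Proof.
apply: (has_sum1 (mindex0, r)); case=> k l.
rewrite /smul_terms /= /sconst seriesZE /mon xpair_eqE.
case: eqP => [->|_] /=; last by rewrite mulr0 !mul0r.
rewrite mon_mul_0l mulr1 eq_sym.
by case: eqP => [->|_]; rewrite ?mulr1 ?mulr0.
Qed.

Lemma smul_sconstl a X : smul (sconst a) X = a *: X.
Proof. by apply: seriesP => r; apply/tsumE/has_sum_smul_sconstl. Qed.

Lemma smul_sconstr a X : smul X (sconst a) = a *: X.
Proof.
apply: seriesP => r; rewrite seriesZE; apply: tsumE.
apply: (has_sum1 (r, mindex0)); case=> l k.
rewrite /smul_terms /= /sconst seriesZE /mon xpair_eqE andbC.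
case: eqP => [->|_] /=; last by rewrite !mulr0 !mul0r.
rewrite mon_mul_0r mulr1 eq_sym mulrC.
by case: eqP => [->|_]; rewrite ?mul1r ?mul0r // mulrC.
Qed.

Lemma smulDl_sconst a X Y : smul_defined X Y ->
  smul (X + sconst a) Y = smul X Y + a *: Y.
Proof.
move=> XY; apply: seriesP => r; rewrite seriesDE seriesZE; apply: tsumE.
apply: eq_has_sum (has_sumD _ _ _ _ (summableE _ (XY r)) (has_sum_smul_sconstl a Y r)).
by move=> kl; rewrite /smul_terms seriesDE !mulrDl.
Qed.

Lemma has_sum_sadjD X Y r s t : has_sum (sadj_terms X r) s ->
  has_sum (sadj_terms Y r) t -> has_sum (sadj_terms (X + Y) r) (s + t).
Proof.
move=> Xs Yt; apply: eq_has_sum (has_sumD _ _ _ _ Xs Yt) => k.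
by rewrite /sadj_terms seriesDE rmorphD mulrDl.
Qed.

Lemma has_sum_sadjZ a X r s : has_sum (sadj_terms X r) s ->
  has_sum (sadj_terms (a *: X) r) (a^* * s).
Proof.
move=> Xs; apply: eq_has_sum (has_sumZ a^* _ _ Xs) => k.
by rewrite /sadj_terms seriesZE rmorphM mulrA.
Qed.

Lemma sadj_definedD X Y : sadj_defined X -> sadj_defined Y -> sadj_defined (X + Y).
Proof.
move=> hX hY r; have [s Xs] := hX r; have [t Yt] := hY r.
by exists (s + t); exact: has_sum_sadjD.
Qed.

Lemma sadj_definedZ a X : sadj_defined X -> sadj_defined (a *: X).
Proof.
by move=> hX r; have [s Xs] := hX r; exists (a^* * s); exact: has_sum_sadjZ.
Qed.

Lemma sadjD X Y : sadj_defined X -> sadj_defined Y ->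
  sadj (X + Y) = sadj X + sadj Y.
Proof.
move=> hX hY; apply: seriesP => r; apply: tsumE.
by apply: has_sum_sadjD; exact: summableE.
Qed.

Lemma sadjZ a X : sadj_defined X -> sadj (a *: X) = a^* *: sadj X.
Proof.
move=> hX; apply: seriesP => r; apply: tsumE.
by apply: has_sum_sadjZ; exact: summableE.
Qed.

Lemma has_sum_sadj_sconst a r : has_sum (sadj_terms (sconst a) r) (sconst a^* r).
Proof.
apply: (has_sum1 mindex0) => k; rewrite /sadj_terms /sconst !seriesZE /mon.
case: eqP => [->|_]; last by rewrite mulr0 rmorph0 mul0r.
by rewrite mon_adj0 mulr1.
Qed.

Lemma sadj_sconst a : sadj (sconst a) = sconst a^* :> series R m.
Proof. by apply: seriesP => r; apply: tsumE; exact: has_sum_sadj_sconst. Qed.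

Lemma inP_sconst a : inP (sconst a : series R m).
Proof.
split; rewrite ?sadj_sconst ?conjCK // => r; eexists; exact: has_sum_sadj_sconst.
Qed.

Lemma inPD X Y : inP X -> inP Y -> inP (X + Y).
Proof.
move=> [X1 X2 XE] [Y1 Y2 YE]; split; rewrite ?sadjD ?XE ?YE //;
  exact: sadj_definedD.
Qed.

Lemma inPZ a X : inP X -> inP (a *: X).
Proof.
move=> [X1 X2 XE]; split; rewrite ?sadjZ ?XE ?conjCK //; exact: sadj_definedZ.
Qed.

Lemma inPN X : inP X -> inP (- X).
Proof. by rewrite -scaleN1r; exact: inPZ. Qed.

Lemma inP0 : inP (0 : series R m).
Proof. by rewrite -(scale0r (sconst 0)); apply/inPZ/inP_sconst. Qed.

Lemma inP_sum n (F : 'I_n -> series R m) :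
  (forall j, inP (F j)) -> inP (\sum_(j < n) F j).
Proof. by move=> FP; elim/big_ind: _ => // [|X Y]; [exact: inP0 | exact: inPD]. Qed.

Lemma inP_sadj X : inP X -> inP (sadj X).
Proof. by move=> [X1 X2 XE]; split; rewrite ?XE. Qed.

Lemma sadj_sum n (F : 'I_n -> series R m) : (forall j, inP (F j)) ->
  sadj (\sum_(j < n) F j) = \sum_(j < n) sadj (F j).
Proof.
(* Membership in [inP] is carried through the induction, since additivity of [sadj] requires the
   adjoint of each partial sum to be defined. *)
move=> FP; suff [] : inP (\sum_(j < n) F j) /\
  sadj (\sum_(j < n) F j) = \sum_(j < n) sadj (F j) by [].
elim/big_rec2: _ => [|j X Y _ [PX EX]].
  split; first exact: inP0.
  by rewrite -(scale0r (sconst 0)) sadjZ ?rmorph0 ?scale0r //; have [] := inP_sconst 0.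
split; first exact: inPD.
by rewrite sadjD ?EX //; [have [] := FP j | have [] := PX].
Qed.

(** By [mon_adj_incr] these terms are, up to a constant factor, the adjoint terms of [X] at
    [incr j r], reindexed along [incr j]. The indices missed have exponent 0 at [j], and
    [mon_adj_incr0] kills their terms. *)
Lemma has_sum_sadj_ham i X r : sadj_defined X ->
  has_sum (sadj_terms (ham i X) r) (ham i (sadj X) r).
Proof.
move=> hX; set j := cbar i.
have := has_sumZ ((if (i < m)%N then 1 else -1) * (r j).+1%:R) _ _
  (summableE _ (hX (incr j r))).
move=> /(has_sum_reindex _ _ _ _ (incrK j)) H.
apply: eq_has_sum (H _) => [k|k]; last first.
  rewrite /sadj_terms => jk; rewrite mon_adj_incr0 ?mulr0 //.
  by apply/eqP; rewrite -leqn0 leqNgt; apply: contra jk => /decrK ->.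
rewrite /sadj_terms /= /ham !rmorphM rmorph_nat.
by case: ifP => _; rewrite ?rmorphN1 ?rmorph1 -!mulrA; congr (_ * _);
  rewrite mulrCA mon_adj_incr mulrCA.
Qed.

Lemma sadj_ham i X : sadj_defined X -> sadj (ham i X) = ham i (sadj X).
Proof. by move=> hX; apply: seriesP => r; apply/tsumE/has_sum_sadj_ham. Qed.

Lemma sadj_defined_ham i X : sadj_defined X -> sadj_defined (ham i X).
Proof. by move=> hX r; eexists; exact: has_sum_sadj_ham. Qed.

Definition herm X : series R m := 2^-1 *: (X + sadj X).

Lemma inO_herm X : inP X -> inO (herm X).
Proof.
move=> PX; have [dX dX' XX] := PX; split; first exact/inPZ/inPD/inP_sadj.
rewrite /herm sadjZ ?sadjD ?XX 1?[X + _]addrC //; last exact: sadj_definedD.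
by rewrite fmorphV rmorph_nat.
Qed.

Lemma inOB X Y : inO X -> inO Y -> inO (X - Y).
Proof.
move=> [PX eX] [PY eY]; split; first exact/inPD/inPN.
have [dX _ _] := PX; have [dNY _ _] := inPN Y PY; have [dY _ _] := PY.
by rewrite sadjD // -eX -scaleN1r sadjZ // -eY rmorphN1.
Qed.

Lemma herm_id X : inO X -> herm X = X.
Proof.
case=> _ eX; rewrite /herm -eX -mulr2n -[X *+ 2]scaler_nat.
by rewrite scalerA mulVf ?scale1r ?pnatr_eq0.
Qed.

Lemma herm_ham i X : sadj_defined X -> herm (ham i X) = ham i (herm X).
Proof. by move=> dX; rewrite /herm sadj_ham // hamZ hamD. Qed.

Lemma hermD X Y : sadj_defined X -> sadj_defined Y ->
  herm (X + Y) = herm X + herm Y.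
Proof. by move=> dX dY; rewrite /herm sadjD // addrACA scalerDr. Qed.

End SeriesOperations.

(** * The zero integral of a Hamiltonian field *)

Section ZeroIntegral.
Context {R : realType} {m n : nat}.
Implicit Types (k : mindex m) (s t : 'I_m) (X : series R m).

(** Integration cancels the factor [d.+1] of the derivative, but monomials free of x_i are lost; the
    sign is that of [ham]. *)
Lemma zint_ham i i' X k : cbar i' = i ->
  zint i (ham i' X) k = if (0 < k i)%N then (if (i' < m)%N then X k else - X k) else 0.
Proof.
move=> ii'; rewrite /zint; case ki: (k i) => [|d] //=.
rewrite /ham ii' ffunE eqxx.
have -> : incr i [ffun j => if j == i then d else k j] = k.
  by apply/ffunP => j; rewrite !ffunE; case: eqP => [->|].
have d0 : d.+1%:R != 0 :> R[i] by rewrite pnatr_eq0.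
by rewrite mulrAC mulfK //; case: ifP => _; rewrite ?mul1r ?mulN1r.
Qed.

Lemma first_nonzero (c : 'I_m -> nat) t : c t != 0%N ->
  exists2 t0, c t0 != 0%N & forall s, c s != 0%N -> (t0 <= s)%N.
Proof.
move=> ct.
by case: (@arg_minnP _ t (fun s => c s != 0%N) (fun s : 'I_m => s) ct) => t0; exists t0.
Qed.

Lemma sum_first (c : 'I_m -> nat) (P : pred 'I_m) (a : R[i]) t :
    c t != 0%N -> P t -> (forall s, c s != 0%N -> P s -> s = t) ->
  \sum_(s < m) (if P s then if (0 < c s)%N then a else 0 else 0) = a.
Proof.
move=> ct Pt uniq_t; rewrite (bigD1 t) //= Pt lt0n ct big1 ?addr0 // => s st.
case: ifP => // Ps; rewrite lt0n; case: ifP => // cs.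
by rewrite (uniq_t s cs Ps) eqxx in st.
Qed.

(* Only the least index among the variables occurring in a monomial, the q's
   coming first, contributes to its coefficient in Z_j, whence Z_j is the
   potential without its constant term. *)
Lemma Zvec_ham (g : 'M[series R m]_(m + m, n)) (W : 'I_n -> series R m) j :
  (forall i, g i j = ham i (W j)) ->
  Zvec g j 0 = W j - sconst (W j mindex0).
Proof.
move=> gW; apply: seriesP => k.
rewrite mxE !(seriesDE, seriesNE, series_sumE) /sconst seriesZE /mon.
pose Pp s := [forall i, (k i != 0)%N ==> (i \in [set pidx t | t : 'I_m & (s <= t)%N])].
pose Pq s := [forall i, (k i != 0)%N ==>
  (i \in [set qidx t | t : 'I_m & (s <= t)%N] :|: [set pidx t | t : 'I_m])].
rewrite (eq_bigr (fun s =>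
  if Pp s then if (0 < k (pidx s))%N then W j k else 0 else 0)); last first.
  by move=> s _; rewrite /restr gW zint_ham ?cbar_q // qidx_lt.
rewrite [X in _ - X](eq_bigr (fun s =>
  if Pq s then if (0 < k (qidx s))%N then - W j k else 0 else 0)); last first.
  by move=> s _; rewrite /restr gW zint_ham ?cbar_p // pidx_lt.
have qset s t : qidx t \in [set qidx t | t : 'I_m & (s <= t)%N]
    :|: [set pidx t | t : 'I_m] -> (s <= t)%N.
  rewrite inE => /orP[/imsetP[u]|/imsetP[u _ /eqP]]; last by rewrite idx_eqE.
  by rewrite inE => su /eqP; rewrite idx_eqE => /eqP ->.
have pset s t : pidx t \in [set pidx t | t : 'I_m & (s <= t)%N] -> (s <= t)%N.
  by case/imsetP=> u; rewrite inE => su /eqP; rewrite idx_eqE => /eqP ->.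
(* If some q occurs in the monomial, every restriction to p's alone removes it, so only the second
   sum of Z can contribute. *)
case: (pickP (fun t => k (qidx t) != 0%N))
  => [t /(first_nonzero (fun t => k (qidx t)))[t0 kt0 t0_min]|q0].
  rewrite big1 => [|s _]; last first.
    case: ifP => // /forallP/(_ (qidx t0)); rewrite kt0 /= => /imsetP[u _ /eqP].
    by rewrite idx_eqE.
  (* The integral requires q_s to occur and the restriction forbids any earlier q, which forces
     [s = t0]. The sign of the p-row bracket cancels the minus sign in Z. *)
  rewrite (sum_first (fun s => k (qidx s)) Pq _ t0) //.
  - case: eqP => [k0|_]; first by rewrite k0 ffunE in kt0.
    by rewrite mulr0 subr0 sub0r opprK.
  - apply/forallP => i; apply/implyP; case: (idxP i) => [[s ->]|[s ->]] ks.
      by rewrite inE imset_f // inE; exact: t0_min.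
    by rewrite inE orbC imset_f.
  move=> s ks /forallP/(_ (qidx t0)); rewrite kt0 /= => /qset st0.
  by apply/val_inj/eqP; rewrite eqn_leq st0 t0_min.
rewrite [X in _ - X]big1 => [|s _]; last first.
  by rewrite lt0n q0 if_same.
rewrite subr0.
case: (pickP (fun t => k (pidx t) != 0%N))
  => [t /(first_nonzero (fun t => k (pidx t)))[t0 kt0 t0_min]|p0].
  rewrite (sum_first (fun s => k (pidx s)) Pp _ t0) //.
  - case: eqP => [k0|_]; first by rewrite k0 ffunE in kt0.
    by rewrite mulr0 subr0.
  - apply/forallP => i; apply/implyP; case: (idxP i) => [[s ->]|[s ->]] ks.
      by rewrite q0 in ks.
    by rewrite imset_f // inE; exact: t0_min.
  move=> s ks /forallP/(_ (pidx t0)); rewrite kt0 /= => /pset st0.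
  by apply/val_inj/eqP; rewrite eqn_leq st0 t0_min.
(* What remains is the constant monomial, which no zero integral produces; this is the term
   subtracted on the right. *)
have -> : k = mindex0.
  apply/ffunP => i; rewrite ffunE; apply/eqP/negbFE.
  by case: (idxP i) => [[s ->]|[s ->]]; [exact: q0 | exact: p0].
by rewrite eqxx mulr1 subrr big1 // => s _; rewrite ffunE if_same.
Qed.

End ZeroIntegral.

(** * Realizability *)

Section Realizability.
Context {R : realType} {m n : nat}.
Implicit Types (f : 'cV[series R m]_(m + m)) (g : 'M[series R m]_(m + m, n)).
Implicit Types (L : 'cV[series R m]_n) (S : 'M[R[i]]_n) (C : 'cV[R[i]]_n).

Lemma comm_xvecE k (J : 'cV[series R m]_k) i j :
  comm xvec J i j = 'i *: ham i (J j 0).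
Proof. by rewrite !mxE !big_ord1 !mxE comm_ham. Qed.

Lemma scaleNi_comm_xvec k (J : 'cV[series R m]_k) i j :
  mxscale (- 'i) (comm xvec J) i j = ham i (J j 0).
Proof. by rewrite mxE comm_xvecE scalerA mulNr mulCii opprK scale1r. Qed.

Lemma commutator_conservativeP k (g : 'M[series R m]_(m + m, k)) :
  commutator_conservative g <->
  exists2 W : 'I_k -> series R m,
    forall j, inP (W j) & forall i j, g i j = ham i (W j).
Proof.
split=> [[J PJ ->]|[W PW gW]].
  by exists (fun j => J j 0) => [j|i j]; [exact: PJ | rewrite scaleNi_comm_xvec].
exists (\col_j W j) => [i j|]; first by rewrite mxE.
by apply/matrixP => i j; rewrite scaleNi_comm_xvec mxE gW.
Qed.

Lemma commutator_conservative_subP f h :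
  commutator_conservative (f - h) <->
  exists2 J, inP J & forall i, f i 0 - h i 0 = ham i J.
Proof.
split=> [/commutator_conservativeP[J PJ fJ]|[J PJ fJ]].
  by exists (J 0) => // i; rewrite -fJ !mxE.
apply/commutator_conservativeP; exists (fun=> J) => // i j.
by rewrite ord1 !mxE fJ.
Qed.

(* The series [S^dagger L]; both [L^dagger S] and [[x, L^T] S^*], hence [f_L] and
   [g], depend on [L] and [S] only through it. *)
Definition unscatter L S j : series R m := \sum_k (S k j)^* *: L k 0.

Lemma mxdag_mul_const L S i j : inPmx L ->
  mxmul (mxdag L) (mxconst S) i j = sadj (unscatter L S j).
Proof.
move=> PL; rewrite sadj_sum => [|k]; last exact/inPZ/PL.
rewrite mxE; apply: eq_bigr => k _; rewrite !mxE smul_sconstr ord1 sadjZ ?conjCK //.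
by have [] := PL k 0.
Qed.

Lemma comm_mul_const L S i j :
  mxmul (comm xvec L) (mxconst (map_mx Num.conj S)) i j = 'i *: ham i (unscatter L S j).
Proof.
rewrite linear_sum scaler_sumr mxE; apply: eq_bigr => k _ /=.
by rewrite comm_xvecE !mxE smul_sconstr hamZ !scalerA mulrC.
Qed.

Lemma const_mul S (V : 'cV[series R m]_n) k :
  mxmul (mxconst S) V k 0 = \sum_l S k l *: V l 0.
Proof. by rewrite mxE; apply: eq_bigr => l _; rewrite mxE smul_sconstl. Qed.

(** The relation S^dagger S = I removes the scattering matrix put into [Lvec]. *)
Lemma unscatter_const_mul S (V : 'cV[series R m]_n) a j : unitary S ->
  unscatter (mxscale a (mxmul (mxconst S) V)) S j = a *: V j 0.
Proof.
move=> [_ SS]; have SSjl l : \sum_k (S k j)^* * S k l = (j == l)%:R.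
  have := congr1 (fun A : 'M_n => A j l) SS; rewrite !mxE => <-.
  by apply: eq_bigr => k _; rewrite !mxE.
transitivity (a *: \sum_l (\sum_k (S k j)^* * S k l) *: V l 0).
  rewrite /unscatter; under [in RHS]eq_bigr => l _ do rewrite scaler_suml.
  rewrite exchange_big scaler_sumr; apply: eq_bigr => k _.
  rewrite mxE const_mul scalerA mulrC -scalerA scaler_sumr; congr (_ *: _).
  by apply: eq_bigr => l _; rewrite scalerA.
rewrite (bigD1 j) //= SSjl eqxx scale1r big1 ?addr0 // => l lj.
by rewrite SSjl eq_sym (negPf lj) scale0r.
Qed.

Lemma unscatter_Lvec g S C j : unitary S ->
  unscatter (Lvec g S C) S j = 'i^-1 *: (Zvec g j 0 + sconst (C j 0)).
Proof. by move=> uS; rewrite unscatter_const_mul // mxE [mxconst _ _ _]mxE. Qed.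

Lemma inPmx_Lvec g S C : inPmx (Zvec g) -> inPmx (Lvec g S C).
Proof.
move=> PZ k j; rewrite ord1 mxE const_mul; apply/inPZ/inP_sum => l.
by rewrite mxE [mxconst _ _ _]mxE; apply/inPZ/inPD; [exact: PZ | exact: inP_sconst].
Qed.

Lemma drift_correctionE L S g i :
  drift_correction L S g i 0 = herm (LSg L S g 0 i).
Proof. by rewrite !mxE. Qed.

Lemma LSgE L S g i : inPmx L ->
  LSg L S g 0 i = \sum_j smul (sadj (unscatter L S j)) (g i j).
Proof.
move=> PL; rewrite mxE; apply: eq_bigr => j _.
by rewrite mxdag_mul_const // [g^T _ _]mxE.
Qed.

Lemma fLE g S C i : fL g S C i 0 = herm (LSg (Lvec g S C) S g 0 i).
Proof. exact: drift_correctionE. Qed.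

Lemma eq_drift_correction L L' S S' g :
    inPmx L -> inPmx L' -> unscatter L S =1 unscatter L' S' ->
  drift_correction L S g = drift_correction L' S' g.
Proof.
move=> PL PL' eqLS; rewrite /drift_correction /LSg.
suff -> : mxmul (mxdag L) (mxconst S) = mxmul (mxdag L') (mxconst S') by [].
by apply/matrixP => i j; rewrite !mxdag_mul_const ?eqLS.
Qed.

Lemma physically_realizable_conservative f g S :
    unitary S -> inPmx (Zvec g) -> physically_realizable f g ->
  exists C, [/\ commutator_conservative g, commutator_conservative (f - fL g S C)
    & forall i, inO (f i 0)].
Proof.
move=> uS PZ [Of [H [L [S' [[PH _] PL _ _ [fE gE]]]]]].
(* By [comm_mul_const], column [j] of [g] is the Hamiltonian field of this series. *)
pose W j := 'i *: unscatter L S' j.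
have PW j : inP (W j) by apply/inPZ/inP_sum => k; exact/inPZ/PL.
have gW i j : g i j = ham i (W j) by rewrite gE comm_mul_const hamZ.
(* These are exactly the constant terms missing from Z, so that Z + C = W. Hence [Lvec] with [S] and
   [L] with [S'] have the same [unscatter], although [S] and [S'] may differ. *)
exists (\col_j W j mindex0); split=> //.
  by apply/commutator_conservativeP; exists W.
apply/commutator_conservative_subP; exists H => // i.
have fiE : f i 0 = ham i H + drift_correction L S' g i 0.
  by rewrite {1}fE [LHS]mxE scaleNi_comm_xvec mxE.
rewrite fiE /fL.
suff -> : drift_correction (Lvec g S (\col_j W j mindex0)) S g =
    drift_correction L S' g by rewrite addrK.
apply: eq_drift_correction => // [|j']; first exact: inPmx_Lvec.
rewrite unscatter_Lvec // mxE (Zvec_ham _ W) // subrK /W scalerA.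
by rewrite mulVf ?scale1r // neq0Ci.
Qed.

(** A constant added to S^dagger L enters through the adjoint, hence conjugated, and multiplies [g]
    as a scalar. *)
Lemma LSg_shift L L' S g (a : 'I_n -> R[i]) i :
    inPmx L -> inPmx L' -> LSg_defined L S g ->
    (forall j, unscatter L' S j = unscatter L S j + sconst (a j)) ->
  LSg L' S g 0 i = LSg L S g 0 i + \sum_j (a j)^* *: g i j.
Proof.
move=> PL PL' [dLS _] L'L; apply: etrans (LSgE _ _ _ i PL') _.
rewrite (LSgE _ _ _ i PL) -big_split; apply: eq_bigr => j _ /=.
have [dLj _ _] : inP (unscatter L S j) by apply: inP_sum => k; exact/inPZ/PL.
have [dc _ _] : inP (sconst (a j) : series R m) by exact: inP_sconst.
rewrite L'L sadjD // sadj_sconst smulDl_sconst //.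
by have := dLS 0 i j; rewrite mxdag_mul_const // [g^T _ _]mxE.
Qed.

Lemma conservative_shift f g S C C' :
    unitary S -> inPmx (Zvec g) -> LSg_defined (Lvec g S C) S g ->
    commutator_conservative g -> commutator_conservative (f - fL g S C) ->
  commutator_conservative (f - fL g S C').
Proof.
move=> uS PZ dL /commutator_conservativeP[W PW gW].
move=> /commutator_conservative_subP[J PJ fJ].
(* The change in S^dagger L = (Z + C)/i when [C] becomes [C']. *)
pose a j := 'i^-1 * (C' j 0 - C j 0).
(* A potential for the resulting change of [LSg]; its Hermitian part is one for the change of
   [fL]. *)
pose U := \sum_j (a j)^* *: W j.
have PU : inP U by apply: inP_sum => j; exact: inPZ.
have [dU _ _] := PU.
have LSgC' i : LSg (Lvec g S C') S g 0 i = LSg (Lvec g S C) S g 0 i + ham i U.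
  have -> : ham i U = \sum_j (a j)^* *: g i j.
    by rewrite linear_sum; apply: eq_bigr => j _ /=; rewrite hamZ -gW.
  apply: LSg_shift => //; try exact: inPmx_Lvec.
  move=> j; apply: etrans (unscatter_Lvec g S C' j uS) _; rewrite unscatter_Lvec //.
  by rewrite sconstM -scalerDr sconstB -addrA [sconst (C j 0) + _]addrC subrK.
have fLC' i : fL g S C' i 0 = fL g S C i 0 + ham i (herm U).
  have [_ /(_ 0 i)[dY _ _]] := dL.
  apply: etrans (fLE g S C' i) _; apply: etrans (congr1 herm (LSgC' i)) _.
  rewrite hermD //; last exact: sadj_defined_ham.
  by rewrite herm_ham //; congr (_ + _); exact/esym/fLE.
apply/commutator_conservative_subP; exists (J - herm U) => [|i].
  by have [PhU _] := inO_herm U PU; exact/inPD/inPN.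
apply: etrans (congr1 (fun X => f i 0 - X) (fLC' i)) _.
by rewrite hamB -fJ opprD addrA.
Qed.

Lemma conservative_physically_realizable f g S C :
    unitary S -> inPmx (Zvec g) -> LSg_defined (Lvec g S C) S g ->
    commutator_conservative g -> commutator_conservative (f - fL g S C) ->
    (forall i, inO (f i 0)) ->
  physically_realizable f g.
Proof.
move=> uS PZ dL /commutator_conservativeP[W PW gW].
move=> /commutator_conservative_subP[J PJ fJ] Of; split=> //.
have [dJ _ _] := PJ.
(* The potential [J] may fail to be self-adjoint, while a Hamiltonian must be. As f - f_L is
   self-adjoint, its Hermitian part is itself, so [herm J] generates the same field. *)
exists (herm J), (Lvec g S C), S; split=> //.
- exact: inO_herm.
- exact: inPmx_Lvec.
split.
  apply/matrixP => i j; rewrite ord1 [RHS]mxE scaleNi_comm_xvec mxE -herm_ham //.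
  rewrite -fJ.
  have OfL : inO (fL g S C i 0).
    by rewrite fLE; apply: inO_herm; case: dL => _; exact.
  by rewrite herm_id; [exact/esym/subrK | exact: inOB].
(* Z differs from the potentials [W] only by constants, which brackets annihilate, as they do
   [C]. *)
apply/matrixP => i j; rewrite comm_mul_const unscatter_Lvec // hamZ scalerA.
rewrite mulfV ?neq0Ci // scale1r (Zvec_ham _ W) // hamD hamB !ham_sconst.
by rewrite subr0 addr0 gW.
Qed.

End Realizability.

(** The hypotheses [hZ] and [hfL] express the convention that the products and adjoints occurring
    are well-defined elements of P_x. *)
Theorem theorem35 (R : realType) (m n : nat) (hm : (1 <= m)%N) (hn : (1 <= n)%N)
    (f : 'cV[series R m]_(m + m)) (g : 'M[series R m]_(m + m, n))
    (S : 'M[R[i]]_n)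
    (hf : inPmx f) (hg : inPmx g) (hS : unitary S)
    (hZ : inPmx (Zvec g))
    (hfL : forall C : 'cV[R[i]]_n, LSg_defined (Lvec g S C) S g) :
  [<-> physically_realizable f g;
       exists C : 'cV[R[i]]_n,
         [/\ commutator_conservative g, commutator_conservative (f - fL g S C)
           & forall i, inO (f i 0)];
       forall C : 'cV[R[i]]_n,
         [/\ commutator_conservative g, commutator_conservative (f - fL g S C)
           & forall i, inO (f i 0)]].
Proof.
split; [|split].
- exact: physically_realizable_conservative.
- move=> [C [cg cf Of]] C'; split; [exact: cg | | exact: Of].
  exact: (conservative_shift f g S C C' hS hZ (hfL C) cg cf).
- move=> /(_ 0)[cg cf Of].
  exact: (conservative_physically_realizable f g S 0 hS hZ (hfL 0) cg cf Of).
Qed.
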